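(* Let $(G,\zeta)_\xi$ be a soft topological group with group operation $\ast$. If $U$ and $V$ are soft path connected subsets of $G$, then $U\ast V=\{u\ast v: u\in U,\ v\in V\}$ is also soft path connected.
   Context: A soft set over a set $X$ with parameter set $\xi$ is a function $W\colon\xi\to\mathcal{P}(X)$. Soft union, soft intersection and soft inclusion $\widetilde{\sqsubseteq}$ of soft sets with parameter set $\xi$ are taken parameterwise; $\emptyset_\xi(e)=\emptyset$ and $X_\xi(e)=X$ for all $e\in\xi$. For $x\in X$, $x\,\widetilde{\in}\,W$ means $x\in W(e)$ for every $e\in\xi$. A soft topology $\zeta$ on $X$ with parameter set $\xi$ is a collection of soft sets over $X$ (with parameter set $\xi$) containing $\emptyset_\xi$ and $X_\xi$ and closed under arbitrary soft unions and under soft intersections of two members; members of $\zeta$ are soft open. A soft open neighborhood of $x$ is a $W\in\zeta$ with $x\,\widetilde{\in}\,W$. For $A\subseteq X$, the soft subspace $(A,\zeta_A)_\xi$ has $\zeta_A=\{W_A:W\in\zeta\}$, $W_A(e)=W(e)\cap A$. A function $\varrho\colon X\to X'$ gives a soft continuous mapping $(\mathbb{I}_\xi,\varrho)\colon(X,\zeta)_\xi\to(X',\zeta')_\xi$ if for every $x\in X$ and every soft open neighborhood $W'$ of $\varrho(x)$ there is a soft open neighborhood $W$ of $x$ with $\varrho(W)\,\widetilde{\sqsubseteq}\,W'$, where $\varrho(W)(e)=\varrho(W(e))$. A soft topological group $(G,\zeta)_\xi$ is a group $(G,\ast)$ with a soft topology $\zeta$ on $G$ with parameter set $\xi$ such that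 (i) for all $(a,b)\in G\times G$ and every soft open neighborhood $W$ of $a\ast b$ there are soft open neighborhoods $U$ of $a$ and $V$ of $b$ with $U\ast V\,\widetilde{\sqsubseteq}\,W$, where $(U\ast V)(e)=U(e)\ast V(e)$; and (ii) the inversion $\iota(a)=a^{-1}$ gives a soft continuous mapping $(\mathbb{I}_\xi,\iota)$ from $(G,\zeta)_\xi$ to itself. The soft usual topology on $\mathbb{R}$ with parameter set $\xi$ is $\mathscr{U}_\xi=\{H^G_\xi: G\subseteq\mathbb{R}\text{ open in the usual topology}\}$, where $H^G_\xi(e)=G$ for all $e\in\xi$; $(I,(\mathscr{U}_\xi)_I)$ is its soft subspace on $I=[0,1]$ (with parameter set $\xi$). A soft path from $x$ to $y$ in $(X,\zeta)_\xi$ is a soft continuous mapping $(\mathbb{I}_\xi,\gamma)\colon(I,(\mathscr{U}_\xi)_I)\to(X,\zeta)_\xi$, where $\gamma\colon I\to X$ is a function with $\gamma(0)=x$, $\gamma(1)=y$. $(X,\zeta)_\xi$ is soft path connected if for all $x,y\in X$ there is a soft path from $x$ to $y$; a subset $A\subseteq X$ is soft path connected if $(A,\zeta_A)_\xi$ is. *)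

(* Defs.v *)
From HB Require Import structures.
From mathcomp Require Import all_boot all_order all_algebra.
From mathcomp Require Import all_classical all_reals.
From mathcomp Require Import topology normedtype.

Set Implicit Arguments.
Unset Strict Implicit.
Unset Printing Implicit Defensive.

Import Order.TTheory GRing.Theory Num.Theory numFieldNormedType.Exports.

Local Open Scope classical_set_scope.

Definition soft_set (xi X : Type) : Type := xi -> set X.

Section SoftSets.
Context {xi X : Type}.
Implicit Types (W V : soft_set xi X) (F : set (soft_set xi X)).

Definition soft_empty : soft_set xi X := fun=> set0.
Definition soft_full : soft_set xi X := fun=> setT.
Definition soft_cst (A : set X) : soft_set xi X := fun=> A.
Definition soft_bigcup F : soft_set xi X := fun e => \bigcup_(W in F) W e.
Definition soft_setI W V : soft_set xi X := fun e => W e `&` V e.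
Definition soft_subset W V : Prop := forall e, W e `<=` V e.
Definition soft_in (x : X) W : Prop := forall e, W e x.

End SoftSets.

Definition soft_image {xi X Y : Type} (f : X -> Y) (W : soft_set xi X) :
  soft_set xi Y := fun e => f @` W e.

Record soft_topology (xi X : Type) := SoftTopology {
  soft_open :> set (soft_set xi X);
  soft_open_empty : soft_open soft_empty;
  soft_open_full : soft_open soft_full;
  soft_open_bigcup : forall F : set (soft_set xi X),
    F `<=` soft_open -> soft_open (soft_bigcup F);
  soft_open_setI : forall W V : soft_set xi X,
    soft_open W -> soft_open V -> soft_open (soft_setI W V)
}.

Definition soft_open_nbhd {xi X : Type} (zeta : soft_topology xi X) (x : X)
  (W : soft_set xi X) : Prop := soft_open zeta W /\ soft_in x W.

Section SoftSubspace.
Context {xi X : Type} (zeta : soft_topology xi X) (A : set X).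

(* The carrier of the subspace is the subtype [set_type A] of [X]; the set
   [W e `&` A] is represented as a subset of this subtype. *)
Definition soft_restrict (W : soft_set xi X) : soft_set xi (set_type A) :=
  fun e => [set a | W e (val a)].

Definition soft_subspace_open : set (soft_set xi (set_type A)) :=
  [set soft_restrict W | W in soft_open zeta].

Lemma soft_subspace_open_empty : soft_subspace_open soft_empty.
Proof. by exists soft_empty; [exact: soft_open_empty|]. Qed.

Lemma soft_subspace_open_full : soft_subspace_open soft_full.
Proof. by exists soft_full; [exact: soft_open_full|]. Qed.

Lemma soft_subspace_open_bigcup (F : set (soft_set xi (set_type A))) :
  F `<=` soft_subspace_open -> soft_subspace_open (soft_bigcup F).
Proof.
move=> FA; exists (soft_bigcup [set W | soft_open zeta W /\ F (soft_restrict W)]).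
  by apply: soft_open_bigcup => W [].
apply/funext => e; apply/seteqP; split => a /=.
  by move=> [W [_ FW] Wa]; exists (soft_restrict W).
move=> [_ /[dup] /FA[W oW <-] FW Wa].
by exists W.
Qed.

Lemma soft_subspace_open_setI (W V : soft_set xi (set_type A)) :
  soft_subspace_open W -> soft_subspace_open V ->
  soft_subspace_open (soft_setI W V).
Proof.
move=> [W' oW' <-] [V' oV' <-].
by exists (soft_setI W' V'); [exact: soft_open_setI|].
Qed.

Definition soft_subspace : soft_topology xi (set_type A) :=
  SoftTopology soft_subspace_open_empty soft_subspace_open_full
    soft_subspace_open_bigcup soft_subspace_open_setI.

End SoftSubspace.

Definition soft_continuous {xi X Y : Type} (zeta : soft_topology xi X)
    (zeta' : soft_topology xi Y) (f : X -> Y) : Prop :=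
  forall (x : X) (W' : soft_set xi Y), soft_open_nbhd zeta' (f x) W' ->
  exists2 W : soft_set xi X,
    soft_open_nbhd zeta x W & soft_subset (soft_image f W) W'.

Section SoftUsual.
Context (xi : Type) (R : realType).

Definition soft_usual_open : set (soft_set xi R) :=
  [set soft_cst H | H in [set H : set R | open H]].

Lemma soft_usual_open_empty : soft_usual_open soft_empty.
Proof. by exists set0; [exact: open0|]. Qed.

Lemma soft_usual_open_full : soft_usual_open soft_full.
Proof. by exists setT; [exact: openT|]. Qed.

Lemma soft_usual_open_bigcup (F : set (soft_set xi R)) :
  F `<=` soft_usual_open -> soft_usual_open (soft_bigcup F).
Proof.
move=> FU; exists (\bigcup_(H in [set H | open H /\ F (soft_cst H)]) H).
  by apply: bigcup_open => H [].
apply/funext => e; apply/seteqP; split => a /=.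
  by move=> [H [_ FH] Ha]; exists (soft_cst H).
by move=> [_ /[dup] /FU[H oH <-] FH Ha]; exists H.
Qed.

Lemma soft_usual_open_setI (W V : soft_set xi R) :
  soft_usual_open W -> soft_usual_open V -> soft_usual_open (soft_setI W V).
Proof.
by move=> [H oH <-] [K oK <-]; exists (H `&` K); [exact: openI|].
Qed.

Definition soft_usual : soft_topology xi R :=
  SoftTopology soft_usual_open_empty soft_usual_open_full
    soft_usual_open_bigcup soft_usual_open_setI.

End SoftUsual.

Definition unit_interval (R : realType) : set R := `[0%R, 1%R].
Arguments unit_interval R : clear implicits.

Section UnitInterval.
Local Open Scope ring_scope.
Context (R : realType).

Lemma unit_interval0 : 0 \in unit_interval R.
Proof. by rewrite inE /unit_interval /= in_itv /= lexx ler01. Qed.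

Lemma unit_interval1 : 1 \in unit_interval R.
Proof. by rewrite inE /unit_interval /= in_itv /= lexx ler01. Qed.

Definition I0 : set_type (unit_interval R) := exist _ 0 unit_interval0.
Definition I1 : set_type (unit_interval R) := exist _ 1 unit_interval1.

End UnitInterval.

Definition is_soft_path (R : realType) {xi X : Type}
    (zeta : soft_topology xi X) (x y : X)
    (gamma : set_type (unit_interval R) -> X) : Prop :=
  [/\ soft_continuous (soft_subspace (soft_usual xi R) (unit_interval R))
        zeta gamma,
      gamma (I0 R) = x & gamma (I1 R) = y].

Definition soft_path_connected (R : realType) {xi X : Type}
    (zeta : soft_topology xi X) : Prop :=
  forall x y : X, exists gamma : set_type (unit_interval R) -> X,
    is_soft_path zeta x y gamma.

Definition soft_path_connected_subset (R : realType) {xi X : Type}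
    (zeta : soft_topology xi X) (A : set X) : Prop :=
  soft_path_connected R (soft_subspace zeta A).

Section SoftGroup.
Local Open Scope group_scope.

Definition set_prod {G : groupType} (A B : set G) : set G :=
  [set a * b | a in A & b in B].

Definition soft_prod {xi : Type} {G : groupType} (U V : soft_set xi G) :
  soft_set xi G := fun e => set_prod (U e) (V e).

Definition soft_topological_group {xi : Type} {G : groupType}
    (zeta : soft_topology xi G) : Prop :=
  (forall (a b : G) (W : soft_set xi G), soft_open_nbhd zeta (a * b) W ->
     exists U V : soft_set xi G,
       [/\ soft_open_nbhd zeta a U, soft_open_nbhd zeta b V &
           soft_subset (soft_prod U V) W]) /\
  soft_continuous zeta zeta (fun a : G => a^-1).

End SoftGroup.

(* Main.v *)
Require Import Defs.
From mathcomp Require Import all_boot all_classical all_reals.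

(** Write the endpoints as products [u1 * v1] and [u2 * v2] with factors in
    [U] and [V], join [u1] to [u2] by a soft path in [U] and [v1] to [v2] by a
    soft path in [V], and multiply the two paths pointwise.  The product takes
    its values in [U * V] and has the right endpoints, and it is soft continuous
    because the group multiplication is ([soft_continuous_mul]).

    A soft path in a soft subspace is the same thing as a soft continuous map
    into the ambient space with values in the subset ([soft_continuous_val] and
    [soft_continuous_corestrict]), so that the multiplication can be carried
    out in the group, where its continuity is known. *)

Set Implicit Arguments.
Unset Strict Implicit.
Unset Printing Implicit Defensive.

Local Open Scope classical_set_scope.

Section SoftSubspaceMaps.
Context {xi X Y : Type} (zX : soft_topology xi X) (zY : soft_topology xi Y).
Context (A : set Y) (f : X -> set_type A).

Lemma soft_continuous_val :
  soft_continuous zX (soft_subspace zY A) f ->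
  soft_continuous zX zY (fun x => val (f x)).
Proof.
move=> cf x W [oW xW].
have [|W1 nW1 W1f] := cf x (soft_restrict W).
  by split; [exists W | exact: xW].
exists W1 => // e _ [z W1z <-].
by apply: (W1f e (f z)); exists z.
Qed.

(** Soft open sets of the subspace are traces of ambient ones, and membership
    in a trace is tested on underlying points. *)
Lemma soft_continuous_corestrict :
  soft_continuous zX zY (fun x => val (f x)) ->
  soft_continuous zX (soft_subspace zY A) f.
Proof.
move=> cf x _ [[W oW <-] xW].
have [|W1 nW1 W1f] := cf x W; first by split.
exists W1 => // e _ [z W1z <-].
by apply: (W1f e (val (f z))); exists z.
Qed.

End SoftSubspaceMaps.

(** The common neighborhood is the soft intersection of those given by the two
    factors; this is where closure of a soft topology under binary soft
    intersections enters. *)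
Lemma soft_continuous_mul {xi X : Type} {G : groupType}
    (zX : soft_topology xi X) (zeta : soft_topology xi G) (f g : X -> G) :
  soft_topological_group zeta ->
  soft_continuous zX zeta f -> soft_continuous zX zeta g ->
  soft_continuous zX zeta (fun x => f x * g x)%g.
Proof.
move=> [mulG _] cf cg x W nW.
have [U [V [nU nV UVW]]] := mulG _ _ _ nW.
have [W1 [oW1 xW1] W1U] := cf x U nU.
have [W2 [oW2 xW2] W2V] := cg x V nV.
exists (soft_setI W1 W2).
  by split; [exact: soft_open_setI | move=> e; split].
move=> e _ [z [W1z W2z] <-]; apply: UVW.
exists (f z); first by apply: W1U; exists z.
by exists (g z) => //; apply: W2V; exists z.
Qed.

Lemma mem_set_prod {G : groupType} (A B : set G) (a : set_type A)
    (b : set_type B) : (val a * val b)%g \in set_prod A B.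
Proof.
by apply/mem_set; exists (val a); [exact: set_valP | exists (val b); [exact: set_valP|]].
Qed.

Theorem theorem5p10 (R : realType) (xi : Type) (G : groupType)
    (zeta : soft_topology xi G) (hG : soft_topological_group zeta)
    (U V : set G)
    (hU : soft_path_connected_subset R zeta U)
    (hV : soft_path_connected_subset R zeta V) :
  soft_path_connected_subset R zeta (set_prod U V).
Proof.
move=> x y.
have [u1 Uu1 [v1 Vv1 xE]] := set_valP x.
have [u2 Uu2 [v2 Vv2 yE]] := set_valP y.
have [f [cf f0 f1]] := hU (SigSub (mem_set Uu1)) (SigSub (mem_set Uu2)).
have [g [cg g0 g1]] := hV (SigSub (mem_set Vv1)) (SigSub (mem_set Vv2)).
exists (fun t => SigSub (mem_set_prod (f t) (g t))); split.
- apply: soft_continuous_corestrict => /=.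
  by apply: soft_continuous_mul => //; exact: soft_continuous_val.
- by apply/val_inj; rewrite /= f0 g0.
- by apply/val_inj; rewrite /= f1 g1.
Qed.
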